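(* Let $N\ge4$, let $K_{2,N-2}$ be the complete bipartite graph with vertex groups $\{1,2\}$ and $\{3,\dots,N\}$, and let $d_1=d_2=2$, $d_3,\dots,d_N\ge2$ arbitrary. A Markov basis of the toric ideal $I_{K_{2,N-2}}$ consists of the following binomials: (1) the quadrics $p_{11K}p_{22K}-p_{12K}p_{21K}$ for all $K\in\prod_{s=3}^N[d_s]$; (2) the quadrics $p_{ij(K,L)}p_{ij(K',L')}-p_{ij(K',L)}p_{ij(K,L')}$ for all $i,j\in[2]$, all subsets $S\subseteq\{3,\dots,N\}$ with complement $T=\{3,\dots,N\}\setminus S$, and all $K,K'\in\prod_{s\in S}[d_s]$, $L,L'\in\prod_{s\in T}[d_s]$, where $(K,L)$ denotes the element of $\prod_{s=3}^N[d_s]$ restricting to $K$ on $S$ and to $L$ on $T$; (3) for every $a\in\{3,\dots,N\}$, all $k_1,k_2\in[d_a]$ and all $L_{11},L_{12},L_{21},L_{22}\in\prod_{s\in\{3,\dots,N\}\setminus\{a\}}[d_s]$, the quartic $$B_{a;k_1,k_2}^{L_{11}L_{12}L_{21}L_{22}}=p_{11(k_1,L_{11})}p_{12(k_2,L_{12})}p_{21(k_2,L_{21})}p_{22(k_1,L_{22})}-p_{11(k_2,L_{11})}p_{12(k_1,L_{12})}p_{21(k_1,L_{21})}p_{22(k_2,L_{22})},$$ where $(k,L)$ denotes the element of $\prod_{s=3}^N[d_s]$ with $a$-th coordinate $k$ and remaining coordinates $L$.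
   Context: $[m]=\{1,\dots,m\}$, $\mathcal X=\prod_{v=1}^N[d_v]$, $x_W=(x_v)_{v\in W}$; $\Bbbk$ is a field. Variables of $\Bbbk[p_x:x\in\mathcal X]$ are written $p_{ijK}$ with $i,j\in[2]$ the states of nodes 1, 2 and $K\in\prod_{s=3}^N[d_s]$. For a graph $G$ on $[N]$, $I_G$ is the kernel of $p_x\mapsto\prod_W\theta^W_{x_W}$, product over all cliques $W$ of $G$, with independent indeterminates $\theta^W_y$, $y\in\prod_{v\in W}[d_v]$. A set of binomials $p^u-p^v\in I_G$ is a Markov basis of $I_G$ if it generates $I_G$; equivalently, its moves $u-v$ connect (by steps $\pm(u-v)$ staying in $\mathbb N^{\mathcal X}$) any two elements of $\mathbb N^{\mathcal X}$ with the same marginals $\sum_{x:\,x_W=y}u_x$ for all cliques $W$ of $G$ and all $y\in\prod_{v\in W}[d_v]$. *)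

(* Defs.v *)
From HB Require Import structures.
From mathcomp Require Import all_boot all_order all_algebra.
From mathcomp Require Export mpoly.

Set Implicit Arguments.
Unset Strict Implicit.
Unset Printing Implicit Defensive.

Import GRing.Theory.
Local Open Scope ring_scope.

(* States of a family of nodes v : V, where node v has d v levels. The levels
   1, ..., d v are represented by the elements 0, ..., d v - 1 of 'I_(d v). *)
Section States.
Variables (V : finType) (d : V -> nat).

Definition state := {dffun forall v : V, 'I_(d v)}.

Definition pstate (W : {set V}) :=
  {dffun forall v : {v : V | v \in W}, 'I_(d (val v))}.

Definition restrict (W : {set V}) (x : state) : pstate W :=
  [ffun v : {v : V | v \in W} => x (val v)].

(* The state (K, L) equal to K on S and to L on the complement of S. *)
Definition glue (S : {set V}) (K : pstate S) (L : pstate (~: S)) : state :=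
  [ffun v => match boolP (v \in S) with
             | AltTrue vS => K (exist _ v vS)
             | AltFalse vNS =>
                 L (exist _ v (etrans (in_setC v S) vNS))
             end].

Lemma in_setC1_neq (a v : V) : v <> a -> v \in [set~ a].
Proof. by move=> /eqP; rewrite !inE. Qed.

(* The state (k, L) equal to k at a and to L elsewhere. *)
Definition insert_at (a : V) (k : 'I_(d a)) (L : pstate [set~ a]) : state :=
  [ffun v => match v =P a with
             | ReflectT va => cast_ord (congr1 d (esym va)) k
             | ReflectF vNa => L (exist _ v (in_setC1_neq vNa))
             end].

End States.

Section ToricIdeal.
Variables (k : fieldType) (V : finType) (e : rel V) (d : V -> nat).

Definition clique (W : {set V}) : bool :=
  [forall u in W, forall v in W, (u != v) ==> e u v].

(* Indices of the indeterminates theta^W_y, W a clique and y a state of W. *)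
Definition param :=
  {W : {W : {set V} | clique W} & pstate d (val W)}.

Definition mpoly_states := {mpoly k[#|{: state d}|]}.
Definition mpoly_params := {mpoly k[#|{: param}|]}.

Definition pvar (x : state d) : mpoly_states := 'X_(enum_rank x).

Definition theta (W : {W : {set V} | clique W}) (y : pstate d (val W)) :
    mpoly_params :=
  'X_(enum_rank (Tagged (fun W => pstate d (val W)) y : param)).

Definition clique_monomial (x : state d) : mpoly_params :=
  \prod_(W : {W : {set V} | clique W}) theta (restrict (val W) x).

(* The k-algebra morphism p_x |-> \prod_W theta^W_(x_W). *)
Definition clique_map (f : mpoly_states) : mpoly_params :=
  f \mPo [tuple clique_monomial (enum_val i) | i < #|{: state d}|].

Definition toric_ideal (f : mpoly_states) : Prop := clique_map f = 0.

End ToricIdeal.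

Arguments toric_ideal k {V} e d f.

Definition ideal_gen (R : comNzRingType) (B : R -> Prop) (f : R) : Prop :=
  exists2 s : seq (R * R),
    (forall c, c \in s -> B c.2) & f = \sum_(c <- s) c.1 * c.2.

Definition is_binomial (k : fieldType) (n : nat) (b : {mpoly k[n]}) : Prop :=
  exists u v : 'X_{1..n}, b = 'X_[u] - 'X_[v].

Definition markov_basis (k : fieldType) (n : nat)
    (I B : {mpoly k[n]} -> Prop) : Prop :=
  (forall b, B b -> is_binomial b /\ I b) /\
  (forall f, I f <-> ideal_gen B f).

Definition complete_bipartite (A B : finType) : rel (A + B)%type :=
  fun u v => match u, v with
             | inl _, inr _ | inr _, inl _ => true
             | _, _ => false
             end.

(* Nodes 1, 2 are inl 0, inl 1 and have two levels; nodes 3, ..., M + 2 are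
   inr 0, ..., inr (M - 1), with numbers of levels given by d. *)
Section K2.
Variables (k : fieldType) (M : nat) (d : 'I_M -> nat).

Definition node : finType := ('I_2 + 'I_M)%type.

Definition K2graph : rel node := @complete_bipartite 'I_2 'I_M.

Definition levels (v : node) : nat :=
  match v with inl _ => 2%N | inr s => d s end.

Definition joint_state (i j : 'I_2) (K : state d) : state levels :=
  [ffun v : node => match v return 'I_(levels v) with
                    | inl a => if a == ord0 then i else j
                    | inr s => K s
                    end].

Definition pijK (i j : 'I_2) (K : state d) : mpoly_states k levels :=
  pvar k (joint_state i j K).

Definition st1 : 'I_2 := ord0.
Definition st2 : 'I_2 := ord_max.

Definition quadric_12 (K : state d) : mpoly_states k levels :=
  pijK st1 st1 K * pijK st2 st2 K - pijK st1 st2 K * pijK st2 st1 K.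

Definition quadric_split (i j : 'I_2) (S : {set 'I_M})
    (K K' : pstate d S) (L L' : pstate d (~: S)) : mpoly_states k levels :=
  pijK i j (glue K L) * pijK i j (glue K' L')
  - pijK i j (glue K L') * pijK i j (glue K' L).

Definition quartic (a : 'I_M) (k1 k2 : 'I_(d a))
    (L11 L12 L21 L22 : pstate d [set~ a]) : mpoly_states k levels :=
  pijK st1 st1 (insert_at k1 L11) * pijK st1 st2 (insert_at k2 L12)
    * pijK st2 st1 (insert_at k2 L21) * pijK st2 st2 (insert_at k1 L22)
  - pijK st1 st1 (insert_at k2 L11) * pijK st1 st2 (insert_at k1 L12)
    * pijK st2 st1 (insert_at k1 L21) * pijK st2 st2 (insert_at k2 L22).

Inductive K2_binomials : mpoly_states k levels -> Prop :=
| K2_quadric_12 K : K2_binomials (quadric_12 K)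
| K2_quadric_split i j S (K K' : pstate d S) (L L' : pstate d (~: S)) :
    K2_binomials (quadric_split i j K K' L L')
| K2_quartic a (k1 k2 : 'I_(d a)) (L11 L12 L21 L22 : pstate d [set~ a]) :
    K2_binomials (quartic k1 k2 L11 L12 L21 L22).

End K2.

Arguments K2_binomials k {M} d _.

(* Main.v *)
(** A toric ideal is spanned by the differences of monomials with equal image,
    so it suffices to connect two multisets u, v of states (i, j, K) with the
    same clique marginals.  The quadrics (2) recombine the coordinates of K
    freely among the elements with given (i, j); hence the class of u is
    determined by the numbers u_ij(s, c) of elements (i, j, K) with K_s = c.  For
    fixed (s, c) the 2 x 2 tables of u and v have the same margins, so they
    differ by t_(s,c) [[1, -1], [-1, 1]], and \sum_c t_(s,c) does not depend on s.
    If this sum is positive, every s has some c = K_s with t_(s,c) > 0, and the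
    quadric (1) at K decreases \sum |t_(s,c)|.  If it is zero but some t_(s,c)
    is not, then t_(s,k1) > 0 > t_(s,k2) for some k1, k2, and the quartic (3) at
    s decreases \sum |t_(s,c)|. *)
Require Import Defs.
From mathcomp Require Import all_boot all_order all_algebra.
From mathcomp Require Import zify.

Set Implicit Arguments.
Unset Strict Implicit.
Unset Printing Implicit Defensive.

(** * Closure properties of generated ideals *)

Section IdealGen.
Import GRing.Theory.
Local Open Scope ring_scope.
Variables (R : comNzRingType) (B : R -> Prop).

Lemma ideal_gen0 : ideal_gen B 0.
Proof. by exists [::] => //; rewrite big_nil. Qed.

Lemma ideal_gen_base b : B b -> ideal_gen B b.
Proof.
move=> Bb; exists [:: (1, b)]; last by rewrite big_seq1 mul1r.
by move=> c; rewrite inE => /eqP->.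
Qed.

Lemma ideal_genD f g : ideal_gen B f -> ideal_gen B g -> ideal_gen B (f + g).
Proof.
move=> [s Bs ->] [t Bt ->]; exists (s ++ t); last by rewrite big_cat.
by move=> c; rewrite mem_cat => /orP[]; [apply: Bs | apply: Bt].
Qed.

Lemma ideal_genM h f : ideal_gen B f -> ideal_gen B (h * f).
Proof.
move=> [s Bs ->]; exists [seq (h * c.1, c.2) | c <- s].
  by move=> _ /mapP[c /Bs Bc ->].
by rewrite big_map mulr_sumr; apply: eq_bigr => c _; rewrite mulrA.
Qed.

Lemma ideal_genN f : ideal_gen B f -> ideal_gen B (- f).
Proof. by rewrite -mulN1r; apply: ideal_genM. Qed.

Lemma ideal_gen_sum (I : eqType) (r : seq I) (F : I -> R) :
  (forall i, i \in r -> ideal_gen B (F i)) ->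
  ideal_gen B (\sum_(i <- r) F i).
Proof.
move=> BF; rewrite big_seq; elim/big_ind: _ => [|f g|//].
  exact: ideal_gen0.
exact: ideal_genD.
Qed.

End IdealGen.

(** * Toric ideals: monomials, marginals and binomials *)

Section Toric.
Import GRing.Theory.
Local Open Scope ring_scope.
Variables (k : fieldType) (V : finType) (e : rel V) (d : V -> nat).
Local Notation X := (state d).
Local Notation P := (mpoly_states k d).

Definition mon (u : seq X) : P := \prod_(x <- u) pvar k x.

Lemma mon_cat u v : mon (u ++ v) = mon u * mon v.
Proof. exact: big_cat. Qed.

Lemma perm_mon u v : perm_eq u v -> mon u = mon v.
Proof. exact: perm_big. Qed.

Lemma mon_X u : exists m, mon u = 'X_[m].
Proof.
rewrite /mon; elim: u => [|x u [m IHu]].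
  by exists 0%MM; rewrite big_nil mpolyX0.
by exists (U_(enum_rank x) + m)%MM; rewrite big_cons IHu mpolyXD.
Qed.

Lemma X_mon m : exists u, 'X_[m] = mon u.
Proof.
rewrite mpolyXE_id; apply: (big_ind (fun f : P => exists u, f = mon u)).
- by exists [::]; rewrite /mon big_nil.
- by move=> _ _ [u ->] [v ->]; exists (u ++ v); rewrite mon_cat.
move=> i _; exists (nseq (m i) (enum_val i)).
by rewrite /mon big_nseq /pvar enum_valK -Monoid.iteropE.
Qed.

Definition param_at (W : {W : {set V} | clique e W}) (y : pstate d (val W)) :
  param e d := Tagged (fun W => pstate d (val W)) y.
Arguments param_at : clear implicits.

Definition clique_expo (u : seq X) : 'X_{1..#|{: param e d}|} :=
  (\sum_(x <- u) \sum_(W : {W : {set V} | clique e W})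
     U_(enum_rank (param_at W (restrict (val W) x))))%MM.

Lemma clique_map_mon u : clique_map e (mon u) = 'X_[clique_expo u].
Proof.
rewrite /clique_map /mon rmorph_prod /= /clique_expo.
rewrite (big_morph _ (@mpolyXD _ _) (@mpolyX0 _ _)).
apply: eq_bigr => x _; rewrite comp_mpolyXU -tnth_nth tnth_mktuple enum_rankK.
by rewrite (big_morph _ (@mpolyXD _ _) (@mpolyX0 _ _)).
Qed.

(** Each state contributes exactly one parameter per clique, so the coordinates of the exponent
    vector are the clique marginals. *)
Lemma clique_expoE u W y :
  clique_expo u (enum_rank (param_at W y)) =
  count_mem y [seq restrict (val W) x | x <- u].
Proof.
rewrite /clique_expo mnm_sumE count_map -sum1_count [RHS]big_mkcond /=.
apply: eq_bigr => x _; rewrite mnm_sumE (bigD1 W) //= mnm1E.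
rewrite (inj_eq enum_rank_inj) big1 => [|W' neqW].
  by rewrite eq_Tagged /= addn0; case: (_ == y).
rewrite mnm1E (inj_eq enum_rank_inj).
by case: eqP => // /(congr1 tag) /= eqW; rewrite eqW eqxx in neqW.
Qed.

(** Monomials are mapped to monomials, so the difference vanishes exactly when the exponent vectors,
    that is the marginals, agree. *)
Lemma toric_binomialP u v :
  toric_ideal k e d (mon u - mon v) <->
  forall W, clique e W ->
    perm_eq [seq restrict W x | x <- u] [seq restrict W x | x <- v].
Proof.
rewrite /toric_ideal.
have -> : clique_map e (mon u - mon v) =
    'X_[clique_expo u] - 'X_[clique_expo v].
  by rewrite -!clique_map_mon /clique_map raddfB.
split=> [/subr0_eq/(congr1 (mcoeff (clique_expo v))) | uv].
  (* Were the exponents different, the coefficients at [clique_expo v] would be 0 and 1. *)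
  rewrite !mcoeffX eqxx; case: eqP => [eq_uv _ W cW | _ /esym/eqP]; last first.
    by rewrite oner_eq0.
  apply/allP=> y _ /=; have := @clique_expoE u (exist _ W cW) y.
  by rewrite eq_uv clique_expoE /= => ->.
apply/eqP; rewrite subr_eq0; apply/eqP; congr 'X_[_]; apply/mnmP=> i.
rewrite -(enum_valK i); case: (enum_val i) => W y.
by rewrite -/(param_at W y) !clique_expoE; apply/permP/uv/(valP W).
Qed.

Lemma toric_ideal_gen (B : P -> Prop) :
  (forall b, B b -> toric_ideal k e d b) ->
  forall f, ideal_gen B f -> toric_ideal k e d f.
Proof.
move=> BI _ [s Bs ->]; rewrite /toric_ideal /clique_map raddf_sum big1_seq //=.
move=> c /Bs/BI; rewrite rmorphM /= /toric_ideal /clique_map => ->.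
by rewrite mulr0.
Qed.

(* Subtract from each monomial of f a chosen monomial of f with the same image:
   the remainder is linear in the image of f, hence zero. *)
Lemma toric_ideal_binomials (B : P -> Prop) :
  (forall u v, toric_ideal k e d (mon u - mon v) ->
     ideal_gen B (mon u - mon v)) ->
  forall f, toric_ideal k e d f -> ideal_gen B f.
Proof.
move=> Bmon f If.
have phi m : exists n, clique_map e ('X_[m] : P) = 'X_[n].
  by have [u ->] := X_mon m; rewrite clique_map_mon; exists (clique_expo u).
have {}phi m : {n | clique_map e ('X_[m] : P) == 'X_[n]}.
  by apply: sigW; have [n ->] := phi m; exists n.
pose im m := sval (phi m).
have imE m : clique_map e ('X_[m] : P) = 'X_[im m] by apply/eqP/(svalP (phi m)).
(* [rep n] is the first support monomial with image [n]; the default [0%MM] is never reached for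
   images of support monomials. *)
pose s := msupp f; pose rep n := nth 0%MM s (index n (map im s)).
have repP m : m \in s -> im (rep (im m)) = im m.
  move=> ms; have ims : im m \in map im s by apply: map_f.
  rewrite /rep -(nth_map _ (im 0%MM)) ?nth_index //.
  by rewrite -(size_map im) index_mem.
have rem0 : \sum_(m <- s) f@_m *: 'X_[rep (im m)] = 0 :> P.
  pose ns := undup (map im s).
  have split_rep m : m \in s -> 'X_[rep (im m)] =
      \sum_(n <- ns) (im m == n)%:R *: ('X_[rep n] : P).
    move=> ms; rewrite (bigD1_seq (im m)) ?undup_uniq //=; last first.
      by rewrite mem_undup map_f.
    rewrite eqxx scale1r big1 ?addr0 // => n /negPf.
    by rewrite eq_sym => ->; rewrite scale0r.
  (* Grouped by image [n], the coefficient of ['X_[rep n]] is the coefficient at [n] of the image of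
     [f]. *)
  rewrite big_seq; under eq_bigr => m ms do rewrite split_rep // scaler_sumr.
  rewrite -big_seq exchange_big big1_seq //= => n _.
  under eq_bigr do rewrite scalerA; rewrite -scaler_suml.
  suff -> : \sum_(m <- s) f@_m * (im m == n)%:R = 0 by rewrite scale0r.
  have : (clique_map e f)@_n = 0 by rewrite [clique_map _ _]If mcoeff0.
  rewrite /clique_map comp_mpolyEX (raddf_sum (mcoeff n)) => cf0.
  rewrite -[RHS]cf0.
 by apply: eq_bigr => m _; rewrite [RHS]mcoeffZ -/(clique_map e _) imE mcoeffX.
have -> : f = \sum_(m <- s) f@_m *: ('X_[m] - 'X_[rep (im m)]).
  under eq_bigr do rewrite scalerBr.
  by rewrite sumrB rem0 subr0; apply: mpolyE.
apply: ideal_gen_sum => m ms; rewrite -mul_mpolyC.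
apply: ideal_genM; have [u Eu] := X_mon m; have [v Ev] := X_mon (rep (im m)).
rewrite Eu Ev; apply: Bmon; rewrite -Eu -Ev /toric_ideal /clique_map raddfB /=.
by rewrite -!/(clique_map e _) !imE repP // subrr.
Qed.

End Toric.

(** * Coordinates of glued and modified states *)

Section States.
Variables (V : finType) (d : V -> nat).

Lemma restrict_eq_in (W : {set V}) (x y : state d) v :
  restrict W x = restrict W y -> v \in W -> x v = y v.
Proof.
by move=> /ffunP xy vW; have := xy (exist _ v vW); rewrite !ffunE.
Qed.

Lemma glue_restrictE (S : {set V}) (x y : state d) v :
  glue (restrict S x) (restrict (~: S) y) v = if v \in S then x v else y v.
Proof.
(* Generalising the witness lets the dependent match in [glue] reduce in each case. *)
rewrite ffunE; move: (boolP (v \in S)).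
by case: {-}_ / => vS; rewrite ffunE /= ?vS ?(negPf vS).
Qed.

Lemma glue_restrict (S : {set V}) (x : state d) :
  glue (restrict S x) (restrict (~: S) x) = x.
Proof. by apply/ffunP=> v; rewrite glue_restrictE if_same. Qed.

Lemma glue_in (S : {set V}) (K : pstate d S) (L L' : pstate d (~: S)) v :
  v \in S -> glue K L v = glue K L' v.
Proof.
move=> vS; rewrite !ffunE; move: (boolP (v \in S)).
by case: {-}_ / => // vNS; case/negP: (vNS).
Qed.

Lemma glue_notin (S : {set V}) (K K' : pstate d S) (L : pstate d (~: S)) v :
  v \notin S -> glue K L v = glue K' L v.
Proof.
move=> vNS; rewrite !ffunE; move: (boolP (v \in S)).
by case: {-}_ / => // vS; case/negP: vNS.
Qed.

Lemma insert_at_eq a (k : 'I_(d a)) (L : pstate d [set~ a]) :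
  insert_at k L a = k.
Proof. by rewrite ffunE; case: eqP => // aa; apply: val_inj. Qed.

Lemma insert_at_neq a (k k' : 'I_(d a)) (L : pstate d [set~ a]) v :
  v != a -> insert_at k L v = insert_at k' L v.
Proof. by rewrite !ffunE; case: eqP. Qed.

Lemma insert_at_restrict a (x : state d) v k :
  v != a -> insert_at k (restrict [set~ a] x) v = x v.
Proof. by rewrite ffunE; case: eqP => // va _; rewrite ffunE. Qed.

Lemma insert_at_id a (x : state d) :
  insert_at (x a) (restrict [set~ a] x) = x.
Proof.
apply/ffunP=> v; case: (eqVneq v a) => [->|/insert_at_restrict->//].
exact: insert_at_eq.
Qed.

End States.

(** * The listed binomials lie in the toric ideal *)

Section Soundness.
Import GRing.Theory.
Local Open Scope ring_scope.
Variables (k : fieldType) (M : nat) (d : 'I_M -> nat).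
Local Notation js := (@joint_state M d).
Local Notation node := (node M).

(** Agreement is asked only at nodes of [W], so changes outside a clique are invisible. *)
Lemma restrict_joint (W : {set node}) i i' j j' (K K' : state d) :
  ((inl st1 : node) \in W -> i = i') -> ((inl st2 : node) \in W -> j = j') ->
  (forall s, (inr s : node) \in W -> K s = K' s) ->
  restrict W (js i j K) = restrict W (js i' j' K').
Proof.
move=> eqi eqj eqK; apply/ffunP=> -[[a|s] vW]; rewrite !ffunE /=;
  last exact: eqK.
case: eqVneq vW => [-> /eqi //|a0 aW]; apply: eqj.
suff -> : st2 = a by []; apply: val_inj.
by move: a0; rewrite -val_eqE /=; case: a {aW} => [[|[]]].
Qed.

Lemma clique_K2_inl (W : {set node}) : clique (@K2graph M) W ->
  (inl st1 : node) \notin W \/ (inl st2 : node) \notin W.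
Proof.
move=> /forall_inP cW; case: (boolP (inl st1 \in W)) => [W1|]; last by left.
by right; apply/negP=> W2; have /forall_inP/(_ _ W2) := cW _ W1.
Qed.

Lemma clique_K2_inr (W : {set node}) s s' : clique (@K2graph M) W ->
  (inr s : node) \in W -> (inr s' : node) \in W -> s = s'.
Proof.
move=> /forall_inP cW Ws Ws'; have /forall_inP/(_ _ Ws') := cW _ Ws.
by rewrite implybF negbK => /eqP[].
Qed.

Lemma quadric_12_mon (K : state d) : quadric_12 k K =
  mon k [:: js st1 st1 K; js st2 st2 K] - mon k [:: js st1 st2 K; js st2 st1 K].
Proof. by rewrite /mon !big_cons !big_nil !mulr1. Qed.

Lemma quadric_split_mon i j (S : {set 'I_M}) (K K' : pstate d S) L L' :
  quadric_split k i j K K' L L' =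
  mon k [:: js i j (glue K L); js i j (glue K' L')] -
  mon k [:: js i j (glue K L'); js i j (glue K' L)].
Proof. by rewrite /mon !big_cons !big_nil !mulr1. Qed.

Lemma quartic_mon a (k1 k2 : 'I_(d a)) L11 L12 L21 L22 :
  quartic k k1 k2 L11 L12 L21 L22 =
  mon k [:: js st1 st1 (insert_at k1 L11); js st1 st2 (insert_at k2 L12);
            js st2 st1 (insert_at k2 L21); js st2 st2 (insert_at k1 L22)] -
  mon k [:: js st1 st1 (insert_at k2 L11); js st1 st2 (insert_at k1 L12);
            js st2 st1 (insert_at k1 L21); js st2 st2 (insert_at k2 L22)].
Proof. by rewrite /mon !big_cons !big_nil !mulr1 !mulrA. Qed.

Lemma K2_binomials_sound b : K2_binomials k d b ->
  is_binomial b /\ toric_ideal k (@K2graph M) (levels d) b.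
Proof.
have binom u v : is_binomial (mon k u - mon k v : mpoly_states k (levels d)).
  by have [m ->] := mon_X k u; have [m' ->] := mon_X k v; exists m, m'.
case=> [K|i j S K K' L L'|a k1 k2 L11 L12 L21 L22].
- rewrite quadric_12_mon; split=> //; apply/toric_binomialP=> W cW /=.
  (* A clique misses node 1 or node 2; forgetting [i] or [j] makes both sides the same multiset. *)
  have [/negPf W1|/negPf W2] := clique_K2_inl cW.
    rewrite (@restrict_joint W st1 st2 st1 st1 K K) ?W1 //.
    rewrite (@restrict_joint W st2 st1 st2 st2 K K) ?W1 //.
    by apply/permP=> p /=; lia.
  rewrite (@restrict_joint W st1 st1 st1 st2 K K) ?W2 //.
  by rewrite (@restrict_joint W st2 st2 st2 st1 K K) ?W2.
- rewrite quadric_split_mon; split=> //; apply/toric_binomialP=> W cW /=.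
  (* The clique has at most one node in the second group, so it does not see [L], [L'] if that node
     is in [S], and does not see [K], [K'] otherwise. *)
  case: (boolP [exists s, (inr s \in W) && (s \in S)]) => [/existsP|noS].
    move=> [s0 /andP[Ws0 Ss0]].
    have SW s : (inr s : node) \in W -> s \in S.
      by move=> Ws; rewrite (clique_K2_inr cW Ws Ws0).
    rewrite (@restrict_joint W i i j j (glue K L) (glue K L')) //.
      rewrite (@restrict_joint W i i j j (glue K' L) (glue K' L')) //.
      by move=> s /SW; apply: glue_in.
    by move=> s /SW; apply: glue_in.
  have SW s : (inr s : node) \in W -> s \notin S.
    move=> Ws; apply: contraNN noS => sS.
    by apply/existsP; exists s; rewrite Ws.
  rewrite (@restrict_joint W i i j j (glue K L) (glue K' L)) //; last first.
    by move=> s /SW; apply: glue_notin.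
  rewrite (@restrict_joint W i i j j (glue K L') (glue K' L')) //; last first.
    by move=> s /SW; apply: glue_notin.
  by apply/permP=> p /=; lia.
rewrite quartic_mon; split=> //; apply/toric_binomialP=> W cW /=.
(* Without [a], exchanging [k1] and [k2] is invisible. With [a], the clique sees neither the [L]
   parts nor one of [i], [j], and each row and each column holds one [k1] and one [k2] on both
   sides. *)
case: (boolP ((inr a : node) \in W)) => [Wa|Wa]; last first.
  have ins i j L : restrict W (js i j (insert_at k1 L)) =
                   restrict W (js i j (insert_at k2 L)).
    apply: restrict_joint => // s Ws; apply: insert_at_neq.
    by apply: contraNneq Wa => <-.
  by rewrite !ins.
have ins c (L L' : pstate d [set~ a]) s :
    (inr s : node) \in W -> insert_at c L s = insert_at c L' s.
  by move=> /(clique_K2_inr cW Wa) <-; rewrite !insert_at_eq.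
have [/negPf W1|/negPf W2] := clique_K2_inl cW.
  have rW c j (L L' : pstate d [set~ a]) :
      restrict W (js st1 j (insert_at c L)) =
      restrict W (js st2 j (insert_at c L')).
    by apply: restrict_joint => [|//|s Ws]; [rewrite W1 | apply: ins].
  rewrite (rW _ _ _ L21) (rW _ _ _ L22) (rW k2 _ _ L21) (rW k1 _ _ L22).
  by apply/permP=> p /=; lia.
have rW c i (L L' : pstate d [set~ a]) :
    restrict W (js i st1 (insert_at c L)) =
    restrict W (js i st2 (insert_at c L')).
  by apply: restrict_joint => [//||s Ws]; [rewrite W2 | apply: ins].
rewrite (rW _ _ _ L12) (rW _ _ _ L22) (rW k2 _ _ L12) (rW k1 _ _ L22).
by apply/permP=> p /=; lia.
Qed.

End Soundness.

(** * Strict comparison of finite sums *)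

Lemma ltn_sum (I : finType) (F G : I -> nat) i0 :
  (forall i, F i <= G i) -> F i0 < G i0 -> \sum_i F i < \sum_i G i.
Proof.
move=> leFG lt0; rewrite (bigD1 i0) //= [ltnRHS](bigD1 i0) //= -addSn.
by apply: leq_add => //; apply: leq_sum.
Qed.

Lemma eq_sum_ltn (I : finType) (F G : I -> nat) i0 :
  \sum_i F i = \sum_i G i -> F i0 < G i0 -> exists i, G i < F i.
Proof.
move=> eqFG lt0; apply/existsP; apply: contraT => /existsPn noi.
have := ltn_sum (fun i => etrans (leqNgt _ _) (noi i)) lt0.
by rewrite eqFG ltnn.
Qed.

Lemma st12 : (st1 == st2) = false. Proof. by []. Qed.
Lemma st21 : (st2 == st1) = false. Proof. by []. Qed.

Lemma ord2P (i : 'I_2) : i = st1 \/ i = st2.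
Proof. by case: i => [[|[]] //= ?]; [left|right]; apply: val_inj. Qed.

(** * Congruence of monomials modulo the listed binomials *)

Section Connectivity.
Import GRing.Theory.
Variables (k : fieldType) (M : nat) (d : 'I_M -> nat).
Hypothesis M_gt0 : 0 < M.
Local Notation T := ('I_2 * 'I_2 * state d)%type.
Local Notation jst := (fun x : T => joint_state x.1.1 x.1.2 x.2).
Local Notation stE := (st12, st21, eqxx).

Definition tmon (u : seq T) : mpoly_states k (levels d) := mon k (map jst u).

(** Algebraic form of connectivity by moves: chaining moves is addition, and adjoining fixed states
    is multiplication by a monomial. *)
Definition eqv u v := ideal_gen (K2_binomials k d) (tmon u - tmon v)%R.

Lemma eqv_perm u v : perm_eq u v -> eqv u v.
Proof.
move=> uv; rewrite /eqv /tmon (perm_mon _ (perm_map jst uv)) subrr.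
exact: ideal_gen0.
Qed.

Lemma eqv_refl u : eqv u u. Proof. exact: eqv_perm. Qed.

Lemma eqv_sym u v : eqv u v -> eqv v u.
Proof. by move/ideal_genN; rewrite opprB. Qed.

Lemma eqv_trans v u w : eqv u v -> eqv v w -> eqv u w.
Proof. by move=> uv /(ideal_genD uv); rewrite addrA subrK. Qed.

Lemma eqv_catl w u v : eqv u v -> eqv (w ++ u) (w ++ v).
Proof.
by move/(ideal_genM (tmon w)); rewrite /eqv mulrBr /tmon !map_cat !mon_cat.
Qed.

Lemma eqv_catr w u v : eqv u v -> eqv (u ++ w) (v ++ w).
Proof.
move=> /(eqv_catl w) wuv; apply: eqv_trans (eqv_perm _) _.
  by rewrite perm_catC.
by apply: eqv_trans wuv (eqv_perm _); rewrite perm_catC.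
Qed.

(** * Recombining coordinates with the quadrics (2) *)

Definition cell (i j : 'I_2) s (c : 'I_(d s)) (x : T) : bool :=
  (x.1 == (i, j)) && (x.2 s == c).

Definition cnt (u : seq T) i j s (c : 'I_(d s)) := count (cell i j c) u.

Lemma cnt_cons i' j' K u i j s (c : 'I_(d s)) :
  cnt ((i', j', K) :: u) i j c = [&& i' == i, j' == j & K s == c] + cnt u i j c.
Proof. by rewrite /cnt /= {1}/cell xpair_eqE andbA. Qed.

Definition same u v := forall i j s (c : 'I_(d s)), cnt u i j c = cnt v i j c.

Lemma same_perm u v : perm_eq u v -> same u v.
Proof. by move=> /permP uv i j s c; apply: uv. Qed.

Lemma extract u i j s (c : 'I_(d s)) : 0 < cnt u i j c ->
  exists K w, perm_eq u ((i, j, K) :: w) /\ K s = c.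
Proof.
rewrite -has_count => /hasP[[ij K] xu /andP[/eqP/= Eij /eqP/= Ks]].
by exists K, (rem (i, j, K) u); rewrite -Eij; split=> //; apply: perm_to_rem.
Qed.

(** The desired state is built one coordinate at a time, the first [n] being already correct. *)
Lemma assemble_upto n u i j (K : state d) :
  (forall s, 0 < cnt u i j (K s)) ->
  exists (K' : state d) w, [/\ eqv u ((i, j, K') :: w), same u ((i, j, K') :: w)
    & forall s : 'I_M, s < n -> K' s = K s].
Proof.
move=> u_gt0; elim: n => [|n [Ky [w [eq_u same_u KyE]]]].
  (* Any state with indices [i], [j] can start; a positive count at one node provides it. *)
  have [K' [w [perm_u _]]] := extract (u_gt0 (Ordinal M_gt0)).
  by exists K', w; split=> //; [apply: eqv_perm | apply: same_perm].
case: (leqP M n) => [leMn|ltnM].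
  by exists Ky, w; split=> // s _; apply: KyE; apply: leq_trans leMn.
pose s := Ordinal ltnM.
case: (eqVneq (Ky s) (K s)) => [Kys|neqs].
  exists Ky, w; split=> // t; rewrite ltnS leq_eqVlt => /orP[/eqP tn|/KyE//].
  by have -> : t = s by apply: val_inj.
(* The front state has the wrong level at [s], so one with the right level remains in [w]. *)
have w_gt0 : 0 < cnt w i j (K s).
  by have := u_gt0 s; rewrite same_u cnt_cons !eqxx (negPf neqs).
have [Kz [w' [perm_w Kzs]]] := extract w_gt0.
(* Exchanging all coordinates from [n] on keeps the correct initial segment of [Ky] and brings in
   [K s] from [Kz]. *)
pose S := [set t : 'I_M | t < n].
pose mix (x y : state d) := glue (restrict S x) (restrict (~: S) y).
have mixE x y t : mix x y t = if t < n then x t else y t.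
  by rewrite glue_restrictE inE.
exists (mix Ky Kz), ((i, j, mix Kz Ky) :: w'); split.
- apply: eqv_trans eq_u _; apply: (@eqv_trans [:: (i, j, Ky), (i, j, Kz) & w']).
    by apply: eqv_perm; rewrite perm_cons.
  apply: (@eqv_catr w' [:: _; _] [:: _; _]); apply: ideal_gen_base.
  rewrite -{1}[Ky](glue_restrict S) -{1}[Kz](glue_restrict S).
  rewrite /tmon /= -quadric_split_mon; exact: K2_quadric_split.
- move=> i' j' t c; rewrite same_u !cnt_cons (same_perm perm_w) !cnt_cons.
  rewrite !mixE; case: ifP => _ //; exact: addnCA.
move=> t; rewrite ltnS leq_eqVlt mixE => /orP[/eqP tn|ltn].
  have -> : t = s by apply: val_inj.
  by rewrite ltnn.
by rewrite ltn KyE.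
Qed.

Lemma assemble u i j (K : state d) : (forall s, 0 < cnt u i j (K s)) ->
  exists w, eqv u ((i, j, K) :: w) /\ same u ((i, j, K) :: w).
Proof.
move=> /(assemble_upto M)[K' [w [eq_u same_u K'E]]]; exists w.
by have <- : K' = K by apply/ffunP=> s; apply: K'E.
Qed.

(** The head of [v] can be assembled inside [u]; both copies are then removed and induction
    applies. *)
Lemma same_eqv u v : same u v -> eqv u v.
Proof.
elim: v u => [|[[i j] K] v IHv] u same_uv.
  case: u same_uv => [|[[i j] K] u same_u]; first by move=> _; apply: eqv_refl.
  have := same_u i j (Ordinal M_gt0) (K (Ordinal M_gt0)).
  by rewrite !cnt_cons !eqxx.
have [s|w [eq_u same_u]] := @assemble u i j K.
  by rewrite same_uv !cnt_cons !eqxx.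
apply: eqv_trans eq_u _; apply: (@eqv_catl [:: _]); apply: IHv => i' j' s c.
by have := same_uv i' j' s c; rewrite same_u !cnt_cons => /addnI.
Qed.

(** * Descent between multisets with equal table margins *)

Definition same_margins u v := forall s (c : 'I_(d s)),
  [/\ cnt u st1 st1 c + cnt u st1 st2 c = cnt v st1 st1 c + cnt v st1 st2 c,
      cnt u st2 st1 c + cnt u st2 st2 c = cnt v st2 st1 c + cnt v st2 st2 c,
      cnt u st1 st1 c + cnt u st2 st1 c = cnt v st1 st1 c + cnt v st2 st1 c
    & cnt u st1 st2 c + cnt u st2 st2 c = cnt v st1 st2 c + cnt v st2 st2 c].

(** An absolute difference: one of the truncated subtractions is zero. Under equal margins the entry
    (1,1) determines the table, so only this entry is compared. *)
Definition diff u v s (c : 'I_(d s)) :=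
  (cnt u st1 st1 c - cnt v st1 st1 c) + (cnt v st1 st1 c - cnt u st1 st1 c).

Definition dist u v := \sum_s \sum_(c < d s) diff u v c.

Definition closer u v := exists u',
  [/\ eqv u u', same_margins u u' & dist u' v < dist u v].

Lemma dist_lt u' u v s (c : 'I_(d s)) :
  (forall t (b : 'I_(d t)), diff u' v b <= diff u v b) ->
  diff u' v c < diff u v c -> dist u' v < dist u v.
Proof.
move=> le_diff lt_diff; apply: (ltn_sum (i0 := s)) => [t|].
  by apply: leq_sum => b _; apply: le_diff.
by apply: ltn_sum lt_diff => b; apply: le_diff.
Qed.

(** By [n11E] this is the total of the (1,1) entries at any node [s]; comparing it for [u] and [v]
    selects the move. *)
Definition n11 (u : seq T) := count (fun x : T => x.1 == (st1, st1)) u.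

Lemma n11E u s : n11 u = \sum_(c < d s) cnt u st1 st1 c.
Proof.
elim: u => [|x u IHu]; first by rewrite big1.
rewrite /cnt /= big_split /= -IHu; congr (_ + _); rewrite /cell.
case: (x.1 == _); last by rewrite big1.
by rewrite (bigD1 (x.2 s)) //= eqxx big1 // => c; rewrite eq_sym => /negPf->.
Qed.

Lemma closer_gt u v : same_margins u v -> n11 v < n11 u -> closer u v.
Proof.
move=> mrg lt_n.
have /fin_all_exists[K0 K0P] s :
    exists c : 'I_(d s), cnt v st1 st1 c < cnt u st1 st1 c.
  apply/existsP; apply: contraTT lt_n => /existsPn le_uv.
  by rewrite -leqNgt !(n11E _ s); apply: leq_sum => c _; rewrite leqNgt.
pose K : state d := [ffun s => K0 s].
have KP s : cnt v st1 st1 (K s) < cnt u st1 st1 (K s) by rewrite ffunE.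
have [s|w [eq_u same_u]] := @assemble u st1 st1 K.
  exact: leq_ltn_trans (KP s).
(* By the margins, the excess of [u] at (1,1) is also an excess at (2,2). *)
have [s|w' [eq_w same_w]] := @assemble w st2 st2 K.
  have := same_u st2 st2 s (K s); rewrite !cnt_cons ?stE add0n.
  by move=> <-; have := mrg s (K s); have := KP s => ? []; lia.
pose u' := [:: (st1, st2, K), (st2, st1, K) & w'].
have uE i j s (c : 'I_(d s)) :
    cnt u i j c = cnt [:: (st1, st1, K), (st2, st2, K) & w'] i j c.
  by rewrite same_u !cnt_cons same_w cnt_cons.
exists u'; split.
- apply: eqv_trans eq_u _; apply: eqv_trans (eqv_catl [:: _] eq_w) _.
  apply: (@eqv_catr w' [:: _; _] [:: _; _]); apply: ideal_gen_base.
  by rewrite /tmon /= -quadric_12_mon; apply: K2_quadric_12.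
- by move=> s c; rewrite !uE !cnt_cons ?stE /=; split; lia.
(* At every node the excess at [K s] drops by one and no other (1,1) entry changes; one node gives
   strictness. *)
apply: (@dist_lt _ _ _ (Ordinal M_gt0) (K (Ordinal M_gt0))) => [s c|].
  rewrite /diff; have := KP s; rewrite !uE !cnt_cons ?stE /=.
  case: eqP => [->|_]; lia.
have := KP (Ordinal M_gt0).
by rewrite /diff !uE !cnt_cons ?stE /=; lia.
Qed.

Lemma closer_eq u v s (c : 'I_(d s)) : same_margins u v -> n11 u = n11 v ->
  cnt u st1 st1 c != cnt v st1 st1 c -> closer u v.
Proof.
move=> mrg eq_n neq_c.
have eq_s : \sum_(c < d s) cnt u st1 st1 c = \sum_(c < d s) cnt v st1 st1 c.
  by rewrite -!n11E.
(* Equal totals at [s] force a surplus at some level and a deficit at another. *)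
have [k1 [k2 [lt1 lt2]]] : exists k1 k2 : 'I_(d s),
    cnt v st1 st1 k1 < cnt u st1 st1 k1 /\ cnt u st1 st1 k2 < cnt v st1 st1 k2.
  move: neq_c; rewrite neq_ltn => /orP[] lt_c.
    by have [k1 lt1] := eq_sum_ltn eq_s lt_c; exists k1, c.
  by have [k2 lt2] := eq_sum_ltn (esym eq_s) lt_c; exists c, k2.
have /extract[K11 [w1 [pw1 K11s]]] : 0 < cnt u st1 st1 k1 by lia.
(* The margins turn the deficit at [k2] into surpluses at (1,2) and (2,1), and the surplus at [k1]
   into one at (2,2). *)
have u12 : 0 < cnt u st1 st2 k2 by have [] := mrg s k2; lia.
have u21 : 0 < cnt u st2 st1 k2 by have [] := mrg s k2; lia.
have u22 : 0 < cnt u st2 st2 k1 by have [] := mrg s k1; lia.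
move: u12 u21 u22; rewrite !(same_perm pw1) !cnt_cons ?stE !add0n.
move=> /extract[K12 [w2 [pw2 K12s]]].
rewrite !(same_perm pw2) !cnt_cons ?stE !add0n.
move=> /extract[K21 [w3 [pw3 K21s]]].
rewrite !(same_perm pw3) !cnt_cons ?stE !add0n.
move=> /extract[K22 [w [pw K22s]]].
pose put b (K : state d) := insert_at b (restrict [set~ s] K).
have putE b (K : state d) : K s = b -> K = put b K.
  by move=> <-; rewrite /put insert_at_id.
have put_s b (K : state d) : put b K s = b by apply: insert_at_eq.
have put_t b (K : state d) t : t != s -> put b K t = K t.
  exact: insert_at_restrict.
pose u0 := [:: (st1, st1, K11), (st1, st2, K12),
  (st2, st1, K21), (st2, st2, K22) & w].
have pu : perm_eq u u0.
  apply: perm_trans pw1 _; rewrite perm_cons; apply: perm_trans pw2 _.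
  by rewrite perm_cons; apply: perm_trans pw3 _; rewrite perm_cons.
pose u' := [:: (st1, st1, put k2 K11), (st1, st2, put k1 K12),
  (st2, st1, put k1 K21), (st2, st2, put k2 K22) & w].
have cnt_t i j t (b : 'I_(d t)) : t != s -> cnt u' i j b = cnt u i j b.
  by move=> ts; rewrite (same_perm pu) !cnt_cons !put_t.
(* Written additively to avoid truncated subtraction: diagonal cells trade [k1] for [k2], the others
   [k2] for [k1]. *)
have cnt_s i j b :
    cnt u' i j b + ((i == j) && (b == k1)) + ((i != j) && (b == k2)) =
    cnt u i j b + ((i == j) && (b == k2)) + ((i != j) && (b == k1)).
  rewrite (same_perm pu) !cnt_cons !put_s K11s K12s K21s K22s.
  rewrite ![_ == b]eq_sym.
  by case: (ord2P i) (ord2P j) => -> [] ->; rewrite ?stE /=; lia.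
exists u'; split.
- apply: eqv_trans (eqv_perm pu) _.
  apply: (@eqv_catr w [:: _; _; _; _] [:: _; _; _; _]); apply: ideal_gen_base.
  rewrite {1}(putE _ _ K11s) {1}(putE _ _ K12s).
  rewrite {1}(putE _ _ K21s) {1}(putE _ _ K22s).
  rewrite /tmon /= -quartic_mon; exact: K2_quartic.
- move=> t; case: (eqVneq t s) => [->|ts] b; last by rewrite !cnt_t.
  have := (cnt_s st1 st1 b, cnt_s st1 st2 b, cnt_s st2 st1 b, cnt_s st2 st2 b).
  by rewrite ?stE /= => -[[[? ?] ?] ?]; split; lia.
have diff_s b : diff u' v b + (b == k1) + (b == k2) = diff u v b.
  have := cnt_s st1 st1 b; rewrite /diff ?stE /= !addn0.
  have neq_k : k1 != k2 by apply: contraTneq lt1 => ->; rewrite -leqNgt ltnW.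
  case: (eqVneq b k1) => [->|_]; first by rewrite (negPf neq_k); lia.
  by case: (eqVneq b k2) => [->|_]; lia.
apply: (@dist_lt _ _ _ s k1) => [t|]; last by rewrite -diff_s eqxx; lia.
case: (eqVneq t s) => [->|ts] b; last by rewrite /diff cnt_t.
by rewrite -(diff_s b); lia.
Qed.

Lemma dist_sym u v : dist u v = dist v u.
Proof. by do 2![apply: eq_bigr => ? _]; rewrite /diff addnC. Qed.

Lemma same_margins_sym u v : same_margins u v -> same_margins v u.
Proof. by move=> uv s c; case: (uv s c). Qed.

Lemma same_margins_trans v u w :
  same_margins u v -> same_margins v w -> same_margins u w.
Proof. by move=> uv vw s c; case: (uv s c) (vw s c) => -> -> -> -> []. Qed.

(** Induction on [dist]: the multiset with larger [n11] is moved, the roles being exchanged if that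
    is [v]. *)
Lemma same_margins_eqv u v : same_margins u v -> eqv u v.
Proof.
have [n] := ubnP (dist u v); elim: n u v => // n IHn u v lt_n mrg.
have IH x y : same_margins x y -> dist x y < n.+1 -> closer x y -> eqv x y.
  move=> mxy lt_xy [x' [eq_x mx lt_x]]; apply: eqv_trans eq_x (IHn _ _ _ _).
    exact: leq_trans lt_x _.
  exact: same_margins_trans (same_margins_sym mx) mxy.
have [lt_uv|lt_vu|eq_n] := ltngtP (n11 u) (n11 v).
- apply/eqv_sym/IH; rewrite 1?dist_sym //; first exact: same_margins_sym.
  by apply: closer_gt => //; apply: same_margins_sym.
- exact/IH/closer_gt.
case: (boolP
  [forall s, forall c : 'I_(d s), cnt u st1 st1 c == cnt v st1 st1 c]).
  (* Equal (1,1) entries and equal margins give equal tables. *)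
  move=> /forallP eq_c; apply: same_eqv => i j s c.
  have /forallP/(_ c)/eqP := eq_c s; have [] := mrg s c.
  by case: (ord2P i) (ord2P j) => -> [] ->; lia.
by move=> /forallPn[s /forallPn[c]] /(closer_eq mrg eq_n)/IH; apply.
Qed.

(** * From edge marginals to row and column margins *)

Lemma count_row (u : seq T) i s (c : 'I_(d s)) :
  count (fun x : T => (x.1.1 == i) && (x.2 s == c)) u =
  cnt u i st1 c + cnt u i st2 c.
Proof.
elim: u => [|[[i' j] K] u IHu] //; rewrite !cnt_cons /= {}IHu.
by case: (ord2P j) => ->; rewrite ?stE; lia.
Qed.

Lemma count_col (u : seq T) j s (c : 'I_(d s)) :
  count (fun x : T => (x.1.2 == j) && (x.2 s == c)) u =
  cnt u st1 j c + cnt u st2 j c.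
Proof.
elim: u => [|[[i j'] K] u IHu] //; rewrite !cnt_cons /= {}IHu.
by case: (ord2P i) => ->; rewrite ?stE; lia.
Qed.

Lemma clique_edge a s : clique (@K2graph M) [set inl a; inr s].
Proof.
apply/forall_inP=> x; rewrite !inE => /orP[]/eqP->;
  by apply/forall_inP=> y; rewrite !inE => /orP[]/eqP->; apply/implyP;
     rewrite ?eqxx.
Qed.

Hypothesis d_gt0 : forall s, 0 < d s.

Lemma toric_same_margins u v :
  toric_ideal k (@K2graph M) (levels d) (tmon u - tmon v)%R -> same_margins u v.
Proof.
move=> /toric_binomialP perm_uv.
pose P a b s (c : 'I_(d s)) (x : T) :=
  ((if a == st1 then x.1.1 else x.1.2) == b) && (x.2 s == c).
have count_uv a b s (c : 'I_(d s)) : count (P a b s c) u = count (P a b s c) v.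
  have [K Ks] : exists K : state d, K s = c.
    pose K0 : state d := [ffun t => Ordinal (d_gt0 t)].
    by exists (insert_at c (restrict [set~ s] K0)); apply: insert_at_eq.
  pose W : {set node M} := [set inl a; inr s].
  (* Placing [b] at both nodes 1 and 2 gives one reference state for either choice of [a]. *)
  have /permP/(_ (pred1 (restrict W (joint_state b b K)))) :=
    perm_uv W (clique_edge a s).
  rewrite !count_map => cntW.
  pose Q x := restrict W (jst x) == restrict W (joint_state b b K).
  suff PQ : Q =1 P a b s c by rewrite -!(eq_count PQ).
  move=> [[i j] L]; rewrite /Q /P /=; apply/eqP/andP => [eqW|[/eqP ib /eqP Ls]].
    have := restrict_eq_in eqW (set21 (inl a : node M) (inr s)).
    have := restrict_eq_in eqW (set22 (inl a : node M) (inr s)).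
    by rewrite !ffunE /= Ks if_same => -> ->; rewrite !eqxx.
  apply: restrict_joint => [||t]; rewrite !inE /=.
  - by move: ib => /[swap] /orP[/eqP[<-]|//]; rewrite eqxx.
  - by move: ib => /[swap] /orP[/eqP[<-]|//].
  by move=> /eqP[->]; rewrite Ls Ks.
move=> s c; have := (count_uv st1 st1 s c, count_uv st1 st2 s c).
have := (count_uv st2 st1 s c, count_uv st2 st2 s c).
by rewrite /P /= !count_row !count_col => -[? ?] [? ?]; split.
Qed.

End Connectivity.

Theorem theorem6p1 (k : fieldType) (N : nat) (hN : (4 <= N)%N)
    (d : 'I_(N - 2) -> nat) (hd : forall s, (2 <= d s)%N) :
  markov_basis (toric_ideal k (@K2graph (N - 2)) (levels d))
               (K2_binomials k d).
Proof.
have M_gt0 : 0 < N - 2 by lia.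
have d_gt0 s : 0 < d s by apply: ltnW.
split=> [b|f]; first exact: K2_binomials_sound.
split; last first.
  by apply: toric_ideal_gen => b Bb; have [] := K2_binomials_sound Bb.
apply: toric_ideal_binomials => u v uv.
(* Right inverse of [joint_state], turning arbitrary monomials into the form [tmon]. *)
pose dec (x : state (levels d)) : 'I_2 * 'I_2 * state d :=
  (x (inl st1), x (inl st2), [ffun s => x (inr s)]).
have decE w : tmon k (map dec w) = mon k w.
  rewrite /tmon -map_comp; congr mon; apply: map_id_in => x _ /=.
  apply/ffunP=> -[a|s]; rewrite !ffunE //=.
  by case: (ord2P a) => ->.
rewrite -!decE in uv *; apply: same_margins_eqv => //.
exact: toric_same_margins uv.
Qed.
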